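(* Suppose that $\kappa_-^0<1$ and that, for some $\alpha\in[0,1]$ and some function $\ell$ slowly varying at $+\infty$, we have $\nu(\varepsilon)\ge \varepsilon^{-\alpha}\ell(1/\varepsilon)$ for all $0<\varepsilon\le1$. Assume, in addition, that $\ell$ is non-decreasing. Fix an integer $r\ge 0$ and let $n_0$ be the smallest integer $n\ge\max\{2,1+r\}$ satisfying the three conditions $$(a)\quad \kappa_{-}\left(\frac 2n\right)\le\frac{1+\kappa_{-}^0}{2},\qquad (b)\quad \left(1-\frac{r}{n}\right)^{n}\ge \frac{e^{-r}}{2},\qquad (c)\quad \int_{0}^{2}u^{r-\alpha}\left(1-\frac{u}{n}\right)^{n}\mathrm du\ge \frac{\gamma(1+r-\alpha,2)}{2}.$$ Then, for all integers $n\ge n_0$, $$\mathbb E M_{n,r}\ge \frac{e^{-r}}{2\,r!}\left[(1-p_\star)^n+\frac{(1-\kappa_{-}^0)\,\gamma(1+r-\alpha,2)}{2^{1-\alpha}\,4^{1+r}}\right] \frac{\ell(n)}{n^{1-\alpha}},$$ where $p_\star=\max\{p_a:a\in\mathcal A\}$.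
   Context: $\mathcal A$ is an at most countable set and $P=\{p_a:a\in\mathcal A\}$ is a probability distribution on $\mathcal A$ ($p_a\in[0,1]$, $\sum_{a}p_a=1$). $X_1,\dots,X_n$ are i.i.d. $\mathcal A$-valued random variables with distribution $P$; $\xi_n(a)=\sum_{i=1}^n\mathbf 1\{X_i=a\}$. For $0\le r\le n$, $M_{n,r}=\sum_{a\in\mathcal A}p_a\mathbf 1\{\xi_n(a)=r\}$. The counting function of $P$ is $\nu(\varepsilon)=|\{a\in\mathcal A:p_a\ge\varepsilon\}|$. For $\varepsilon\in(0,1]$, $\kappa_-(\varepsilon)=\sup_{0<u\le\varepsilon}\nu(u)/\nu(u/2)\in[0,1]$, where the ratio $0/0$ is interpreted as $0$; $\kappa_-$ is non-decreasing and $\kappa_-^0=\lim_{\varepsilon\to0}\kappa_-(\varepsilon)$. A function $\ell:[0,+\infty)\to\mathbb R$ is slowly varying at $+\infty$ if $\ell(cx)/\ell(x)\to1$ as $x\to+\infty$ for every $c>0$. The lower incomplete Gamma function is $\gamma(t,x)=\int_0^x u^{t-1}e^{-u}\,\mathrm du$ (equal to $+\infty$ when $t=0$, $x>0$). *)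

(* Defs.v *)
From HB Require Import structures.
From mathcomp Require Import all_boot all_order all_algebra.
From mathcomp Require Import finmap.
From mathcomp Require Import all_classical all_reals all_analysis.

Set Implicit Arguments.
Unset Strict Implicit.
Unset Printing Implicit Defensive.

Import Order.TTheory GRing.Theory Num.Theory.
Import numFieldNormedType.Exports.

Local Open Scope classical_set_scope.
Local Open Scope ring_scope.

Definition is_distribution (R : realType) (A : countType) (p : A -> R) : Prop :=
  (forall a, 0 <= p a <= 1) /\ (\esum_(a in [set: A]) (p a)%:E = 1)%E.

(* A carries the discrete sigma-algebra, so every subset of A is an event for
   each X i. *)
Definition iid_with_law (R : realType) (A : countType) (p : A -> R)
    (d : measure_display) (T : measurableType d) (Pr : probability T R)
    (n : nat) (X : 'I_n -> T -> A) : Prop :=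
  [/\ forall i (B : set A), measurable (X i @^-1` B),
      forall i a, Pr (X i @^-1` [set a]) = (p a)%:E
    & forall (J : {set 'I_n}) (B : 'I_n -> set A),
        Pr (\bigcap_(i in [set` J]) (X i @^-1` B i)) =
        (\prod_(i in J) Pr (X i @^-1` B i))%E].

Definition xi (A : countType) (T : Type) (n : nat) (X : 'I_n -> T -> A)
    (a : A) (w : T) : nat :=
  (\sum_(i < n) (X i w == a))%N.

(* When p is a distribution the sum is at most 1, so fine loses nothing. *)
Definition M (R : realType) (A : countType) (p : A -> R) (T : Type) (n : nat)
    (X : 'I_n -> T -> A) (r : nat) (w : T) : R :=
  fine (\esum_(a in [set: A]) (p a * (xi X a w == r)%:R)%:E).

(* When p is a distribution the set is finite for eps > 0, the only values of
   eps used; fset_set would send an infinite set to the empty one. *)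
Definition nu (R : realType) (A : countType) (p : A -> R) (eps : R) : nat :=
  #|` fset_set [set a | eps <= p a] |.

(* Division in R satisfies 0 / 0 = 0, as required here.  The ratios lie in
   [0, 1], so this is a genuine real supremum. *)
Definition kappa_minus (R : realType) (A : countType) (p : A -> R) (eps : R) : R :=
  sup [set (nu p u)%:R / (nu p (u / 2))%:R | u in `]0, eps]].

Definition kappa0 (R : realType) (A : countType) (p : A -> R) : R :=
  lim (kappa_minus p eps @[eps --> (0 : R)^'+]).

(* The supremum is attained when p is a distribution, so it is the maximum. *)
Definition pstar (R : realType) (A : countType) (p : A -> R) : R :=
  sup (range p).

(* Functions on [0, +oo[ are total functions R -> R, only whose values on
   [0, +oo[ matter. Since x / 0 = 0, the limit forces l x != 0 for large x. *)
Definition slowly_varying (R : realType) (l : R -> R) : Prop :=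
  forall c : R, 0 < c -> l (c * x) / l x @[x --> +oo] --> (1 : R).

(* Extended-real valued: equal to +oo for t = 0 and x > 0. *)
Definition lower_gamma (R : realType) (t x : R) : \bar R :=
  (\int[@lebesgue_measure R]_(u in `]0%R, x]) (u `^ (t - 1) * expR (- u))%:E)%E.

Definition n0_conditions (R : realType) (A : countType) (p : A -> R)
    (alpha : R) (r n : nat) : Prop :=
  [/\ (maxn 2 (1 + r) <= n)%N,
      kappa_minus p (2 / n%:R) <= (1 + kappa0 p) / 2,
      expR (- r%:R) / 2 <= (1 - r%:R / n%:R : R) ^+ n
    & (lower_gamma (1 + r%:R - alpha) 2 * (2^-1)%:E <=
       \int[@lebesgue_measure R]_(u in `]0%R, 2%R])
          (u `^ (r%:R - alpha) * (1 - u / n%:R) ^+ n)%:E)%E].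

Definition is_least (Q : nat -> Prop) (n : nat) : Prop :=
  Q n /\ forall m, Q m -> (n <= m)%N.

(* Main.v *)
Require Import Defs.
From HB Require Import structures.
From mathcomp Require Import all_boot all_order all_algebra.
From mathcomp Require Import finmap.
From mathcomp Require Import all_classical all_reals all_analysis.
From mathcomp Require Import measurable_realfun.
From mathcomp Require Import ring lra zify.

Import Order.TTheory GRing.Theory Num.Theory.
Import numFieldNormedType.Exports.

Local Open Scope classical_set_scope.
Local Open Scope ring_scope.

Set Implicit Arguments.
Unset Strict Implicit.
Unset Printing Implicit Defensive.

(** The expectation of [M p X r] is the sum over atoms [a] of
    [C(n,r) p_a^(r+1) (1 - p_a)^(n-r)], and condition (b) turns
    [C(n,r) (1 - p_a)^(n-r)] into at least
    [e^(-r) / (2 r!) * n^r (1 - p_a)^n] ([binomial_weight_ge]).  It remains to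
    bound [n^r * sum_a p_a^(r+1) (1 - p_a)^n] from below, and the atoms are cut
    at the levels [v_k = 2^(-k) / n] ([sum_large_atoms_ge]).

    The atoms of mass at least [v_0 = 1/n] number [nu (1/n) >= n^alpha l n], and
    each weighs at least [(1/n)^(r+1) (1 - pstar)^n]: this is the first term of
    the bound.  For the second one, condition (a) says that halving a level
    below [2/n] multiplies [nu] by a factor bounded away from 1, so a fixed
    fraction, [(1 - kappa0)/2], of the atoms counted by [nu v_(k+1)] has
    mass below [v_k] ([nu_increment_ge]).  As [l] is non-decreasing,
    [nu v_(k+1)] is at least [2^((k+1) alpha) n^alpha l n], and block [k]
    contributes a constant times
    [2^(-(k+1)(r+1-alpha)) (1 - 2^(-k)/n)^n] ([expectation_lower_bound]).

    This dyadic series dominates the integral of condition (c): bounding each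
    factor [u^r], [u^(-alpha)], [(1 - u/n)^n] by its supremum for
    [2^(-k) < u <= 2^(1-k)] costs the factor [2^(1-alpha) 4^r]
    ([integral_le_dyadic_sum]), and (c) compares the integral with half of the
    incomplete Gamma function.  The remaining factor 4 in the denominator of the
    claim collects the two halves lost in (a) and (c).  The comparison is made between
    extended reals: if [gamma] is infinite, a bounded series would dominate an
    infinite integral, so the case [l n > 0] cannot occur, while for
    [l n <= 0] the lower bound is non-positive.

    That [n0] exists and that (a), (b), (c) persist for all larger [n] rests on
    two elementary facts on [(1 - u/n)^n]: it is non-decreasing in
    [n >= u], and it is at least [e^(-u)/2] once [n >= u] and [n >= 2 u^2].  The
    second one holds for all [u <= 2] as soon as [n >= 8], so that (c) follows by monotonicity of the integral alone,
    whether [gamma] is finite or not. *)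

(** * Elementary estimates for powers of 1 - u / n *)

(** Weighted arithmetic-geometric mean inequality, cleared of roots. *)
Lemma mulr_exp_le_convex (R : realFieldType) (x y : R) (n : nat) :
  0 <= x -> 0 <= y -> n.+1%:R * x ^+ n * y <= y ^+ n.+1 + n%:R * x ^+ n.+1.
Proof.
move=> x0 y0; elim: n => [|n ihn]; first by rewrite expr0 expr1; lra.
have step : 0 <= (y - x) * (y ^+ n.+1 - x ^+ n.+1).
  have [yx|/ltW xy] := leP y x.
    by apply: mulr_le0; rewrite subr_le0 ?lerXn2r.
  by apply: mulr_ge0; rewrite subr_ge0 ?lerXn2r.
have := ler_wpM2l x0 ihn.
rewrite -subr_ge0 => ih; rewrite -subr_ge0.
suff -> : y ^+ n.+2 + n.+1%:R * x ^+ n.+2 - n.+2%:R * x ^+ n.+1 * y =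
  (x * (y ^+ n.+1 + n%:R * x ^+ n.+1) - x * (n.+1%:R * x ^+ n * y)) +
  (y - x) * (y ^+ n.+1 - x ^+ n.+1) by exact: addr_ge0.
by rewrite !exprS -!natr1; ring.
Qed.

(** With [x = 1 - u/j] and [y = 1 - u/(j+1)] one has [(j+1) y = j x + 1]: [y] is
    the mean of [j] copies of [x] and one 1, so the arithmetic-geometric mean
    inequality gives [x^j <= y^(j+1)]. *)
Lemma exp_one_sub_div_le (R : realFieldType) (u : R) (m n : nat) :
  0 <= u -> u <= m%:R -> (0 < m)%N -> (m <= n)%N ->
  (1 - u / m%:R) ^+ m <= (1 - u / n%:R) ^+ n.
Proof.
move=> u0 um m0 mn; rewrite -(subnKC mn); elim: (n - m)%N => [|k ihk].
  by rewrite addn0.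
apply: (le_trans ihk); rewrite addnS; set j := (m + k)%N.
have j0 : (0 : R) < j%:R by rewrite ltr0n /j; lia.
have uj : u <= j%:R by apply: (le_trans um); rewrite ler_nat leq_addr.
have j10 : (0 : R) < j.+1%:R by rewrite ltr0n.
have uj1 : u <= j.+1%:R by apply: (le_trans uj); rewrite ler_nat.
set x := 1 - u / j%:R; set y := 1 - u / j.+1%:R.
have x0 : 0 <= x by rewrite subr_ge0 ler_pdivrMr// mul1r.
have y0 : 0 <= y by rewrite subr_ge0 ler_pdivrMr// mul1r.
have xy : j.+1%:R * y = j%:R * x + 1.
  by rewrite /x /y !mulrBr !mulr1 ![_%:R * (u / _)]mulrC !divfK ?gt_eqF// -natr1; ring.
have := mulr_exp_le_convex j x0 y0.
by rewrite -mulrA (mulrC (x ^+ j)) mulrA xy !exprS; lra.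
Qed.

Lemma bernoulli_sub (R : realFieldType) (t : R) (n : nat) :
  0 <= t <= 1 -> 1 - n%:R * t <= (1 - t) ^+ n.
Proof.
move=> /andP[t0 t1]; elim: n => [|n ihn]; first by rewrite expr0; lra.
have n0 : (0 : R) <= n%:R by rewrite ler0n.
have t1' : 0 <= 1 - t by rewrite subr_ge0.
rewrite exprS; apply: le_trans (ler_wpM2l t1' ihn).
by rewrite -natr1; nra.
Qed.

(** With [x = u/n], [(1 - x) e^x >= (1 - x)(1 + x) = 1 - x^2]; raised to the
    power [n], this is at least [1 - n x^2 = 1 - u^2/n >= 1/2] by Bernoulli. *)
Lemma half_expRN_le_exp (R : realType) (u : R) (n : nat) :
  0 <= u -> u <= n%:R -> 2 * u ^+ 2 <= n%:R -> (0 < n)%N ->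
  expR (- u) / 2 <= (1 - u / n%:R) ^+ n.
Proof.
move=> u0 un uun n0; have n0' : (0 : R) < n%:R by rewrite ltr0n.
set x := u / n%:R.
have xu : u = x * n%:R by rewrite divfK// gt_eqF.
have x0 : 0 <= x by rewrite divr_ge0// ltW.
have x1 : x <= 1 by rewrite ler_pdivrMr// mul1r.
have le1 : 1 - x ^+ 2 <= (1 - x) * expR x.
  by have := expR_ge1Dx x; nra.
have le2 : 1 / 2 <= (1 - x ^+ 2) ^+ n.
  apply: (@le_trans _ _ (1 - n%:R * x ^+ 2)); last first.
    by apply: bernoulli_sub; apply/andP; split; nra.
  have : n%:R * x ^+ 2 <= 1 / 2; last by lra.
  have -> : n%:R * x ^+ 2 = u ^+ 2 / n%:R.
    by rewrite /x; field; rewrite gt_eqF.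
  by rewrite ler_pdivrMr//; lra.
have le3 : (1 - x ^+ 2) ^+ n <= (1 - x) ^+ n * expR u.
  rewrite xu [x * _]mulrC expRM_natl -exprMn.
  by apply: lerXn2r => //; rewrite nnegrE; [nra|apply: mulr_ge0; [lra|exact: expR_ge0]].
have le4 := le_trans le2 le3.
have e0 := expR_gt0 u.
rewrite expRN ler_pdivrMr// -[leLHS]mul1r ler_pdivrMr//; nra.
Qed.

(** * The counting function and its ratios *)

Lemma size_mul_le_sum (R : numDomainType) (I : eqType) (s : seq I) (f : I -> R)
    (c : R) :
  (forall i, i \in s -> c <= f i) -> (size s)%:R * c <= \sum_(i <- s) f i.
Proof.
move=> cf; rewrite mulr_natl -count_predT -iter_addr_0 -big_const_seq.
by rewrite big_seq [leRHS]big_seq ler_sum.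
Qed.

Lemma esum_fset_le (R : realType) (A : choiceType) (f : A -> \bar R)
    (F : {fset A}) :
  (\sum_(a <- F) f a <= \esum_(a in [set: A]) f a)%E.
Proof.
apply: esum_ge; exists [set` F]; first by split=> //; exact: finite_fset.
by rewrite fsbig_seq//; exact: fset_uniq.
Qed.

Section distribution.
Context {R : realType} {A : countType} (p : A -> R).
Hypothesis hp : is_distribution p.

Let p_le1 a : p a <= 1. Proof. by have /andP[] := hp.1 a. Qed.

Lemma sum_distribution_le1 (F : {fset A}) : \sum_(a <- F) p a <= 1.
Proof. by rewrite -lee_fin -sumEFin -hp.2; exact: esum_fset_le. Qed.

(** More than [1/eps] atoms of mass at least [eps] would have total mass above 1. *)
Lemma finite_large_atoms (eps : R) :
  0 < eps -> finite_set [set a | eps <= p a].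
Proof.
move=> e0; apply: contrapT => /infinite_set_fset.
move=> /(_ (Num.truncn eps^-1).+1)[F Fp cF].
have := sum_distribution_le1 F; rewrite leNgt => /negP; apply.
have lt1 : 1 < eps * #|` F|%:R.
  rewrite -ltr_pdivrMl// mulr1 -truncn_lt_nat//.
  by rewrite ltW// invr_gt0.
apply: (lt_le_trans lt1).
by rewrite mulrC; apply: size_mul_le_sum => a /Fp.
Qed.

Lemma distribution_neq0 : exists a : A, True.
Proof.
apply: contrapT => /forallNP noA; have := hp.2.
rewrite (_ : [set: A] = set0) ?esum_set0; last first.
  by rewrite -subset0 => a; have := noA a.
by move/eqP; rewrite eq_sym onee_eq0.
Qed.

Lemma pstar_ge (a : A) : p a <= pstar p.
Proof.
by apply: ub_le_sup; [exists 1 => _ [b _ <-]; exact: p_le1|exists a].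
Qed.

Lemma pstar_le1 : pstar p <= 1.
Proof.
by apply: ge_sup => [|_ [b _ <-]//]; have [a _] := distribution_neq0; exists (p a), a.
Qed.

Lemma nu_antitone (u v : R) : 0 < u -> u <= v -> (nu p v <= nu p u)%N.
Proof.
move=> u0 uv; apply: fsubset_leq_card; rewrite -fset_set_sub.
- by move=> a /=; exact: le_trans.
- by apply: finite_large_atoms; exact: lt_le_trans uv.
- exact: finite_large_atoms.
Qed.

Let nu_ratio (u : R) := (nu p u)%:R / (nu p (u / 2))%:R : R.

Let nu_ratio_ge0 u : 0 <= nu_ratio u. Proof. by rewrite divr_ge0. Qed.

Let nu_ratio_le1 u : 0 < u -> nu_ratio u <= 1.
Proof.
move=> u0; have : (nu p u <= nu p (u / 2))%N by apply: nu_antitone; lra.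
rewrite /nu_ratio; have [-> |n0 le] := eqVneq (nu p (u / 2)) 0%N.
  by rewrite invr0 mulr0.
by rewrite ler_pdivrMr ?mul1r ?ler_nat// ltr0n lt0n.
Qed.

Let kappa_has_sup (eps : R) : 0 < eps ->
  has_sup [set nu_ratio u | u in `]0, eps]].
Proof.
move=> e0; split; first by exists (nu_ratio eps), eps => //=; rewrite in_itv/= e0 lexx.
by exists 1 => x [u /=]; rewrite in_itv/= => /andP[u0 _] <-; exact: nu_ratio_le1.
Qed.

Let nu_ratio_le_kappa (u eps : R) :
  0 < u -> u <= eps -> nu_ratio u <= kappa_minus p eps.
Proof.
move=> u0 ue; apply: sup_upper_bound.
  by apply: kappa_has_sup; exact: lt_le_trans ue.
by exists u => //=; rewrite in_itv/= u0 ue.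
Qed.

Lemma nu_le_kappa (u eps : R) : 0 < u -> u <= eps ->
  (nu p u)%:R <= kappa_minus p eps * (nu p (u / 2))%:R.
Proof.
move=> u0 ue; have le : (nu p u <= nu p (u / 2))%N by apply: nu_antitone; lra.
have [h0 |h0] := eqVneq (nu p (u / 2)) 0%N.
  by move: le; rewrite h0 leqn0 => /eqP ->; rewrite mulr0.
rewrite -ler_pdivrMr ?ltr0n ?lt0n//; exact: nu_ratio_le_kappa.
Qed.

Lemma kappa_minus_monotone (eps eps' : R) :
  0 < eps -> eps <= eps' -> kappa_minus p eps <= kappa_minus p eps'.
Proof.
move=> e0 ee; apply: ge_sup; first by have [] := kappa_has_sup e0.
move=> x [u /=]; rewrite in_itv/= => /andP[u0 ue] <-.
by apply: nu_ratio_le_kappa => //; exact: le_trans ee.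
Qed.

(** [kappa_minus p] is monotone and non-negative on positive reals, so its right
    limit at 0 exists; only then does [kappa0], a [lim], have the intended value. *)
Lemma kappa_minus_cvg : kappa_minus p eps @[eps --> (0 : R)^'+] --> kappa0 p.
Proof.
have /cvgP : kappa_minus p eps @[eps --> (0 : R)^'+] -->
  inf [set kappa_minus p x | x in `]0, 1[]; last by [].
apply: (@nondecreasing_at_right_cvgr _ _ _ (BLeft 1)) => //=.
- by rewrite bnd_simp.
- move=> x y; rewrite !in_itv/= => /andP[x0 _] _; exact: kappa_minus_monotone.
- exists 0 => y [x /=]; rewrite in_itv/= => /andP[x0 _] <-.
  exact: le_trans (nu_ratio_ge0 x) (nu_ratio_le_kappa x0 _).
Qed.

Lemma kappa_minus_lt_near0 (c : R) : kappa0 p < c ->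
  exists2 eps, 0 < eps & forall u, 0 < u <= eps -> kappa_minus p u < c.
Proof.
move=> hc; have /cvgrPdist_lt/(_ (c - kappa0 p)) := kappa_minus_cvg.
rewrite subr_gt0 => /(_ hc)[e /= e0 he]; exists (e / 2); first by lra.
move=> u /andP[u0 ue]; have := he u; rewrite /ball_/= sub0r normrN.
rewrite gtr0_norm// => /(_ _ u0).
have ue' : u < e by lra.
by move=> /(_ ue'); rewrite ltr_distlC => /andP[]; lra.
Qed.

End distribution.

(** * The binomial law of the multiplicities *)

Section multiplicity.
Context {R : realType} {A : countType} (p : A -> R) (n : nat).
Context {d : measure_display} {T : measurableType d} (Pr : probability T R).
Context (X : 'I_n -> T -> A).
Hypothesis Xiid : iid_with_law p Pr X.

(** The event that [J] is exactly the set of indices at which [a] is drawn.  It is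
    written as an intersection over the full index set so that independence
    applies to it directly. *)
Let hits (a : A) (J : {set 'I_n}) : set T :=
  \bigcap_(i in [set` [set: 'I_n]%SET])
     (X i @^-1` (if i \in J then [set a] else ~` [set a])).

Let in_hits a J w : hits a J w <-> J = [set i | X i w == a]%SET.
Proof.
split=> [Jw | -> i _ /=]; last first.
  by rewrite inE; case: eqP.
apply/setP => i; rewrite inE.
have /(_ _) := Jw i; rewrite /= inE => /(_ isT) /=.
by case: ifP => _ /eqP; [move=> ->|move/negbTE ->].
Qed.

Let measurable_hits a J : measurable (hits a J).
Proof.
have [mX _ _] := Xiid.
by apply: fin_bigcap_measurable => [|i _]; [exact: finite_finset|exact: mX].
Qed.

Let prob_hits a J : Pr (hits a J) = (p a ^+ #|J| * (1 - p a) ^+ (n - #|J|))%:E.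
Proof.
have [mX lawX indX] := Xiid.
rewrite /hits indX.
have prX i : Pr (X i @^-1` (if i \in J then [set a] else ~` [set a])) =
    (if i \in J then p a else 1 - p a)%:E.
  case: ifP => _; first exact: lawX.
  by rewrite -preimage_setC probability_setC ?lawX//; exact: mX.
under eq_bigr do rewrite prX.
rewrite prodEFin; congr _%:E.
rewrite (bigID (mem J)) /=; congr (_ * _).
  rewrite (eq_bigr (fun=> p a)); last by move=> i /andP[_ ->].
  rewrite prodr_const; congr (_ ^+ _); apply: eq_card => i.
  by rewrite unfold_in /= inE.
rewrite (eq_bigr (fun=> 1 - p a)); last by move=> i /andP[_ /negbTE ->].
rewrite prodr_const; congr (_ ^+ _).
have -> : (n - #|J|)%N = #|(~: J)%SET|.
  by have := cardsC J; rewrite card_ord; lia.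
by apply: eq_card => i; rewrite unfold_in /= !inE.
Qed.

Let xi_card a w : xi X a w = #|[set i | X i w == a]|%SET.
Proof.
rewrite -sum1dep_card big_mkcond /=.
by apply: eq_bigr => i _; case: (X i w == a).
Qed.

Let xi_level a r :
  [set w | xi X a w = r] =
  \bigcup_(J in [set` [pred J : {set 'I_n} | #|J| == r]]) hits a J.
Proof.
apply/seteqP; split=> [w /= xiw | w [J /=]].
  exists [set i | X i w == a]%SET; last exact/in_hits.
  by rewrite /= inE -xi_card xiw.
by rewrite inE => /eqP cJ /in_hits JE; rewrite xi_card -JE.
Qed.

Lemma measurable_xi_level a r : measurable [set w | xi X a w = r].
Proof.
by rewrite xi_level; apply: fin_bigcup_measurable => [|J _]; [exact: finite_finset|].
Qed.

Lemma prob_xi a r : (r <= n)%N ->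
  Pr [set w | xi X a w = r] =
  ('C(n, r)%:R * p a ^+ r * (1 - p a) ^+ (n - r))%:E.
Proof.
move=> rn; rewrite xi_level measure_fin_bigcup//=.
- rewrite -(@bigfs _ _ _ _ (index_enum _)) ?index_enum_uniq//; last first.
    by move=> J _; rewrite mem_index_enum.
  rewrite (eq_bigr (fun=> (p a ^+ r * (1 - p a) ^+ (n - r))%:E)); last first.
    by move=> J /eqP <-; exact: prob_hits.
  rewrite sumEFin sumr_const -[in LHS]mulr_natl -mulrA.
  congr (_%:R * _)%:E; rewrite -[n in RHS]card_ord -card_draws cardsE.
  exact: eq_card.
- by move=> J K _ _ [w [/in_hits -> /in_hits ->]].
Qed.
End multiplicity.

(** * From the expectation to finite sums over atoms *)

(** The integral of a non-negative function is a supremum over the simple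
    functions below it, hence monotone without measurability; this spares a
    proof that [M p X r], an infinite sum, is measurable. *)
Lemma ge0_le_integral_nomeas (R : realType) (d : measure_display)
    (T : measurableType d) (mu : {measure set T -> \bar R})
    (f g : T -> \bar R) :
  (forall w, 0 <= f w)%E -> (forall w, f w <= g w)%E ->
  (\int[mu]_w f w <= \int[mu]_w g w)%E.
Proof.
move=> f0 fg; have g0 w : (0 <= g w)%E := le_trans (f0 w) (fg w).
rewrite !ge0_integralTE//; apply: le_ereal_sup => _ [h /= hf <-].
by exists h => //= w; exact: le_trans (fg w).
Qed.

Section expectation.
Context {R : realType} {A : countType} (p : A -> R) (n : nat).
Context {d : measure_display} {T : measurableType d} (Pr : probability T R).
Context (X : 'I_n -> T -> A).
Hypothesis hp : is_distribution p.
Hypothesis Xiid : iid_with_law p Pr X.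

Lemma M_ge (r : nat) (F : {fset A}) (w : T) :
  \sum_(a <- F) p a * (xi X a w == r)%:R <= M p X r w.
Proof.
have p01 := hp.1.
set f := fun a => (p a * (xi X a w == r)%:R)%:E.
have f0 a : (0 <= f a)%E.
  by rewrite lee_fin mulr_ge0//; have /andP[] := p01 a.
rewrite -lee_fin -sumEFin /M fineK; first exact: esum_fset_le.
rewrite ge0_fin_numE; last by apply: esum_ge0 => a _; exact: f0.
apply: (@le_lt_trans _ _ 1%E); last exact: ltry.
(* The series is dominated by the total mass 1, so [fine] changes nothing. *)
rewrite -hp.2; apply: le_esum => a _; rewrite lee_fin.
have /andP[pa _] := p01 a.
by rewrite ler_piMr// lern1 leq_b1.
Qed.

(** Finite sets of atoms suffice for a lower bound, and avoid exchanging an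
    infinite sum with the integral. *)
Lemma expectation_M_ge (r : nat) (F : {fset A}) : (r <= n)%N ->
  ((\sum_(a <- F) 'C(n, r)%:R * p a ^+ r.+1 * (1 - p a) ^+ (n - r))%:E
   <= 'E_Pr[M p X r])%E.
Proof.
move=> rn; have p0 a : 0 <= p a by have /andP[] := hp.1 a.
rewrite expectation.unlock.
apply: (@le_trans _ _
    (\int[Pr]_w (\sum_(a <- F) p a * (xi X a w == r)%:R)%:E)%E); last first.
  apply: ge0_le_integral_nomeas => w; last by rewrite lee_fin M_ge.
  by rewrite lee_fin sumr_ge0// => a _; rewrite mulr_ge0.
have splitE a w : ((p a * (xi X a w == r)%:R)%:E =
    (p a)%:E * (\1_[set v | xi X a v = r] w)%:E)%E.
  rewrite -EFinM indicE; congr (_ * _%:R)%:E.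
  congr (nat_of_bool _); apply/idP/idP => [/eqP xir|/set_mem /= ->]; last exact: eqxx.
  by rewrite inE.
have mxi a := measurable_xi_level Xiid a r.
under eq_integral do rewrite -sumEFin.
under eq_integral do under eq_bigr do rewrite splitE.
rewrite ge0_integral_sum//; last 2 first.
- move=> a; apply: measurable_funeM.
  by apply/measurable_EFinP; exact: measurable_indic.
- by move=> a w _; rewrite mule_ge0// lee_fin.
rewrite -sumEFin; apply: lee_sum => a _.
rewrite ge0_integralZl//; last 2 first.
- by apply/measurable_EFinP; exact: measurable_indic.
- by rewrite lee_fin.
rewrite integral_indic//.
have prE : (Pr : {measure set T -> \bar R}) [set w | xi X a w = r] = _ :=
  prob_xi Xiid a rn.
rewrite setIT prE -EFinM lee_fin exprS.
by rewrite -!mulrA mulrCA.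
Qed.
End expectation.

(** * The conditions defining n0 *)

Section conditions.
Context {R : realType}.
Local Notation mu := (@lebesgue_measure R).

Lemma measurable_powR_mul (D : set R) (b : R) (g : R -> R) :
  measurable D -> measurable_fun D g ->
  measurable_fun D (fun u => (u `^ b * g u)%:E).
Proof.
move=> mD mg; apply/measurable_EFinP; apply: measurable_funM => //.
by apply: measurable_funTS; exact: measurable_powR.
Qed.

Lemma measurable_exp_one_sub (D : set R) (n : nat) :
  measurable D -> measurable_fun D (fun u : R => (1 - u / n%:R) ^+ n).
Proof.
move=> mD; apply: measurable_funX; apply: measurable_funB => //.
exact: measurable_funM.
Qed.

Lemma measurable_gamma_integrand (D : set R) (b : R) :
  measurable D -> measurable_fun D (fun u => (u `^ b * expR (- u))%:E).
Proof.
move=> mD; apply: measurable_powR_mul => //.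
by apply: measurableT_comp => //; exact: measurable_expR.
Qed.

Lemma exp_one_sub_ge0 (u : R) (n : nat) :
  u <= 2 -> (2 <= n)%N -> 0 <= (1 - u / n%:R) ^+ n.
Proof.
move=> u2 n2; have n0 : (0 : R) < n%:R by rewrite ltr0n; lia.
apply: exprn_ge0; rewrite subr_ge0 ler_pdivrMr// mul1r.
by apply: (le_trans u2); rewrite ler_nat.
Qed.

(** [8 = 2 * 2^2] makes [half_expRN_le_exp] available at every [u <= 2]. *)
Lemma half_lower_gamma_le (b : R) (n : nat) : (8 <= n)%N ->
  (lower_gamma (b + 1) 2 * (2^-1)%:E <=
   \int[mu]_(u in `]0%R, 2%R]) (u `^ b * (1 - u / n%:R) ^+ n)%:E)%E.
Proof.
move=> n8; have n8' : (8 : R) <= n%:R by rewrite ler_nat.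
rewrite /lower_gamma addrK muleC -ge0_integralZl//; last 2 first.
- exact: measurable_gamma_integrand.
- by move=> u _; rewrite lee_fin mulr_ge0// ?powR_ge0// expR_ge0.
apply: ge0_le_integral => //.
- move=> u _; rewrite -EFinM lee_fin !mulr_ge0// ?powR_ge0// ?expR_ge0//.
- by apply: measurable_funeM; exact: measurable_gamma_integrand.
- by apply: measurable_powR_mul => //; exact: measurable_exp_one_sub.
move=> u /=; rewrite in_itv/= => /andP[u0 u2].
rewrite -EFinM lee_fin mulrCA ler_wpM2l ?powR_ge0// mulrC.
by apply: half_expRN_le_exp; [lra|lra|nra|lia].
Qed.

Lemma integral_exp_one_sub_monotone (b : R) (m n : nat) :
  (2 <= m)%N -> (m <= n)%N ->
  (\int[mu]_(u in `]0%R, 2%R]) (u `^ b * (1 - u / m%:R) ^+ m)%:E <=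
   \int[mu]_(u in `]0%R, 2%R]) (u `^ b * (1 - u / n%:R) ^+ n)%:E)%E.
Proof.
move=> m2 mn; have m2' : (2 : R) <= m%:R by rewrite ler_nat.
apply: ge0_le_integral => //.
- move=> u /=; rewrite in_itv/= => /andP[u0 u2].
  by rewrite lee_fin mulr_ge0 ?powR_ge0 ?exp_one_sub_ge0.
- by apply: measurable_powR_mul => //; exact: measurable_exp_one_sub.
- by apply: measurable_powR_mul => //; exact: measurable_exp_one_sub.
move=> u /=; rewrite in_itv/= => /andP[u0 u2].
rewrite lee_fin ler_wpM2l ?powR_ge0//.
by apply: exp_one_sub_div_le; [lra|lra|lia|].
Qed.

Context {A : countType} (p : A -> R) (alpha : R) (r : nat).
Hypothesis hp : is_distribution p.

Lemma n0_conditions_upward (m n : nat) : (m <= n)%N ->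
  n0_conditions p alpha r m -> n0_conditions p alpha r n.
Proof.
move=> mn [m2 mkappa mexp mint].
have m2' : (2 <= m)%N by lia.
have m0 : (0 : R) < m%:R by rewrite ltr0n; lia.
have mn' : m%:R <= n%:R :> R by rewrite ler_nat.
split; first exact: leq_trans m2 mn.
- apply: le_trans mkappa; apply: kappa_minus_monotone => //.
    by rewrite divr_gt0//; lra.
  by rewrite ler_pM2l// lef_pV2// posrE; lra.
- apply: (le_trans mexp); apply: exp_one_sub_div_le => //; last by lia.
  by rewrite ler_nat; lia.
- by apply: (le_trans mint); exact: integral_exp_one_sub_monotone.
Qed.

Lemma exists_n0_conditions :
  kappa0 p < 1 -> exists n, n0_conditions p alpha r n.
Proof.
move=> hkappa.
have hlt : kappa0 p < (1 + kappa0 p) / 2 by lra.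
have [e e0 he] := kappa_minus_lt_near0 hp hlt.
(* 8 serves (c), [r + 2 r^2] serves (b), and the last summand, which exceeds
   [2/e], serves (a). *)
pose n := (8 + r + 2 * r ^ 2 + (Num.truncn (2 / e)).+1)%N; exists n.
have n0 : (0 : R) < n%:R by rewrite ltr0n /n; lia.
have en : 2 / e < n%:R.
  rewrite -truncn_lt_nat; first by rewrite /n; lia.
  by rewrite divr_ge0// ltW.
split; first by rewrite /n; lia.
- apply/ltW/he; rewrite divr_gt0//= ler_pdivrMr// mulrC.
  by rewrite -ler_pdivrMr// ltW.
- apply: half_expRN_le_exp => //; first by rewrite ler_nat /n; lia.
  by rewrite -natrX -natrM ler_nat /n; lia.
- have -> : 1 + r%:R - alpha = r%:R - alpha + 1 by lra.
  by apply: half_lower_gamma_le; rewrite /n; lia.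
Qed.

End conditions.

Lemma exists_least (Q : nat -> Prop) : (exists n, Q n) ->
  exists n, is_least Q n.
Proof.
move=> [n Qn]; have exQ : exists n, `[< Q n >] by exists n; exact/asboolP.
case: (ex_minnP exQ) => m /asboolP Qm minm; exists m; split => // k Qk.
exact/minm/asboolP.
Qed.

(** * Cutting the atoms into blocks *)

Lemma sum_fset_sub (V : nmodType) (I : choiceType) (F G : {fset I}) (f : I -> V) :
  (F `<=` G)%fset ->
  \sum_(a <- G) f a = \sum_(a <- F) f a + \sum_(a <- (G `\` F)%fset) f a.
Proof.
move=> /fsubsetP FG; rewrite (big_fsetID _ (mem F)) /=; congr (_ + _).
  congr (\sum_(a <- enum_fset _) f a).
  by apply/fsetP => a; rewrite !inE /=; case: (boolP (a \in F)) => [/FG ->|]; rewrite ?andbF.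
congr (\sum_(a <- enum_fset _) f a).
by apply/fsetP => a; rewrite !inE andbC.
Qed.

Section blocks.
Context {R : realType} {A : countType} (p : A -> R).
Hypothesis hp : is_distribution p.

Let atoms (eps : R) := fset_set [set a | eps <= p a].

Let mem_atoms eps a : 0 < eps -> (a \in atoms eps) = (eps <= p a).
Proof.
by move=> e0; rewrite in_fset_set ?mem_setE//; exact: finite_large_atoms.
Qed.

(** In the block [v_(k+1) <= p_a < v_k] the factor [p_a^m] is at least
    [v_(k+1)^m] and [(1 - p_a)^n] at least [(1 - v_k)^n]; the block has
    [nu v_(k+1) - nu v_k] elements. *)
Lemma sum_large_atoms_ge (v : nat -> R) (m n K : nat) :
  (forall k, 0 < v k <= 1) -> (forall k, v k.+1 <= v k) ->
  (nu p (v 0%N))%:R * (v 0%N ^+ m * (1 - pstar p) ^+ n) +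
  \sum_(k < K) ((nu p (v k.+1))%:R - (nu p (v k))%:R) *
     (v k.+1 ^+ m * (1 - v k) ^+ n)
  <= \sum_(a <- atoms (v K)) p a ^+ m * (1 - p a) ^+ n.
Proof.
move=> v01 vdec; have p01 := hp.1.
have v_gt0 k : 0 < v k by have /andP[] := v01 k.
have v_le1 k : v k <= 1 by have /andP[] := v01 k.
have ps1 : 0 <= 1 - pstar p by rewrite subr_ge0 pstar_le1.
elim: K => [|K ihK].
  rewrite big_ord0 addr0; apply: size_mul_le_sum => a.
  rewrite mem_atoms// => va; apply: ler_pM.
  - by rewrite exprn_ge0// ltW.
  - by rewrite exprn_ge0.
  - by rewrite lerXn2r// nnegrE ltW// (lt_le_trans (v_gt0 0%N)).
  - rewrite lerXn2r// ?nnegrE ?subr_ge0; first by have /andP[] := p01 a.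
    by rewrite lerD2l lerN2 pstar_ge.
have sub : (atoms (v K) `<=` atoms (v K.+1))%fset.
  by apply/fsubsetP => a; rewrite !mem_atoms//; exact: le_trans.
rewrite big_ord_recr /= addrA (sum_fset_sub _ sub); apply: lerD => //.
have -> : (nu p (v K.+1))%:R - (nu p (v K))%:R =
    #|` (atoms (v K.+1) `\` atoms (v K))%fset|%:R :> R.
  by rewrite cardfsDS// natrB// fsubset_leq_card.
apply: size_mul_le_sum => a; rewrite !inE !mem_atoms// -ltNge => /andP[av va].
have /andP[pa0 pa1] := p01 a.
apply: ler_pM.
- by rewrite exprn_ge0// ltW.
- by rewrite exprn_ge0// subr_ge0.
- by rewrite lerXn2r// nnegrE ltW.
- by rewrite lerXn2r// ?nnegrE ?subr_ge0// lerD2l lerN2 ltW.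
Qed.
End blocks.

(** Each of the [r] factors of [n ^_ r] is at least [n - r = n (1 - r/n)]; as
    [r <= n], the power [r] of [1 - r/n] may be replaced by the power [n], which
    is what condition (b) controls. *)
Lemma exp_mul_one_sub_le_ffact (R : realFieldType) (r n : nat) :
  (r <= n)%N -> (0 < n)%N ->
  n%:R ^+ r * (1 - r%:R / n%:R) ^+ n <= (n ^_ r)%:R :> R.
Proof.
move=> rn n0; have n0' : (0 : R) < n%:R by rewrite ltr0n.
have rn' : r%:R <= n%:R :> R by rewrite ler_nat.
have x0 : 0 <= 1 - r%:R / n%:R :> R by rewrite subr_ge0 ler_pdivrMr// mul1r.
have x1 : 1 - r%:R / n%:R <= 1 :> R.
  by rewrite gerBl divr_ge0.
apply: (@le_trans _ _ (((n - r) ^ r)%:R)); last first.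
  rewrite ler_nat ffact_prod -[X in (_ ^ X <= _)%N](card_ord r) -prod_nat_const.
  by apply: leq_prod => i _; have := ltn_ord i; lia.
rewrite natrX natrB//.
have -> : n%:R - r%:R = n%:R * (1 - r%:R / n%:R) :> R.
  by field; rewrite gt_eqF.
by rewrite exprMn ler_wpM2l ?exprn_ge0// ler_wiXn2l.
Qed.

Lemma binomial_weight_ge (R : realType) (r n : nat) (x : R) :
  (r <= n)%N -> (0 < n)%N -> 0 <= x <= 1 ->
  expR (- r%:R) / 2 <= (1 - r%:R / n%:R : R) ^+ n ->
  expR (- r%:R) / (2 * (r`!)%:R) * (n%:R ^+ r * (x ^+ r.+1 * (1 - x) ^+ n))
  <= 'C(n, r)%:R * x ^+ r.+1 * (1 - x) ^+ (n - r).
Proof.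
move=> rn n0 /andP[x0 x1] hb.
have f0 : (0 : R) < (r`!)%:R by rewrite ltr0n fact_gt0.
rewrite -[leRHS]mulrA mulrA; apply: ler_pM.
- by rewrite mulr_ge0// ?exprn_ge0// divr_ge0// ?expR_ge0// mulr_ge0// ltW.
- by rewrite mulr_ge0 ?exprn_ge0// subr_ge0.
- rewrite -(ler_pM2r f0) -[leRHS]natrM bin_ffact.
  apply: le_trans (exp_mul_one_sub_le_ffact R rn n0).
  have -> : expR (- r%:R) / (2 * (r`!)%:R) * n%:R ^+ r * (r`!)%:R =
      n%:R ^+ r * (expR (- r%:R) / 2) :> R.
    by field; rewrite gt_eqF.
  by rewrite ler_wpM2l ?exprn_ge0.
- rewrite ler_wpM2l ?exprn_ge0// ler_wiXn2l ?leq_subr//; lra.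
Qed.

(** * Dyadic bound for the integral *)

Section dyadic.
Context {R : realType}.
Local Notation mu := (@lebesgue_measure R).

Definition dyadic (k : nat) : R := (2^-1) ^+ k.

Lemma dyadic_gt0 k : 0 < dyadic k.
Proof. by rewrite exprn_gt0// invr_gt0. Qed.

Lemma dyadicS k : dyadic k = 2 * dyadic k.+1.
Proof. by rewrite /dyadic exprS mulrA divff// mul1r. Qed.

Lemma dyadic_antitone j k : (j <= k)%N -> dyadic k <= dyadic j.
Proof. by move=> jk; apply: ler_wiXn2l => //; lra. Qed.

Lemma dyadic_le1 k : dyadic k <= 1.
Proof. by have := @dyadic_antitone 0%N k isT; rewrite {2}/dyadic expr0. Qed.

Lemma dyadic_lt (u : R) : 0 < u -> exists k, dyadic k < u.
Proof.
move=> u0; exists (Num.truncn u^-1).+1; set k := _.+1.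
rewrite /dyadic exprVn invf_plt ?posrE// ?exprn_gt0//.
apply: (@lt_trans _ _ k%:R).
  by rewrite -truncn_lt_nat// invr_ge0 ltW.
by rewrite -natrX ltr_nat ltn_expl.
Qed.

Lemma itv02_bigcup :
  `]0, 2]%classic = \bigcup_k `]dyadic k, 2 * dyadic k]%classic :> set R.
Proof.
apply/seteqP; split=> [u /= | u [k _] /=]; rewrite !in_itv/= => /andP[].
  move=> u0 u2; have [k ku mink] := ex_minnP (dyadic_lt u0).
  exists k => //=; rewrite in_itv/= ku /=.
  case: k ku mink => [|k] ku mink; first by rewrite /dyadic expr0; lra.
  by rewrite -dyadicS leNgt; apply/negP => /mink; rewrite ltnn.
move=> ku uk; have := dyadic_gt0 k; have := dyadic_le1 k.
by move=> ? ?; apply/andP; split; lra.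
Qed.

Lemma trivIset_dyadic :
  trivIset setT (fun k => `]dyadic k, 2 * dyadic k]%classic).
Proof.
apply: ltn_trivIset => k j jk; rewrite -subset0 => u [] /=.
rewrite !in_itv/= => /andP[ju _] /andP[_ uk].
by have := dyadic_antitone jk; have := dyadicS j; lra.
Qed.

Lemma exp_one_sub_antitone (h u : R) (n : nat) : (2 <= n)%N ->
  h <= u -> u <= 2 -> (1 - u / n%:R) ^+ n <= (1 - h / n%:R) ^+ n.
Proof.
move=> n2 hu u2; have n2' : (2 : R) <= n%:R by rewrite ler_nat.
have n0 : (0 : R) < n%:R by lra.
have un : u / n%:R <= 1 by rewrite ler_pdivrMr// mul1r; lra.
have hun : h / n%:R <= u / n%:R by rewrite ler_pM2r// invr_gt0.
by rewrite lerXn2r// ?nnegrE; lra.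
Qed.

(** For [h < u <= 2h], [u^r] is bounded by its value at the right end, while [u^(-alpha)] and
    [(1 - u/n)^n] by theirs at the left end; splitting [u^(r-alpha)] treats
    both signs of [r - alpha] at once. *)
Lemma integral_dyadic_block_le (alpha h : R) (r n : nat) :
  0 <= alpha -> (2 <= n)%N -> 0 < h -> h <= 1 ->
  (\int[mu]_(u in `]h, (2 * h)%R])
     (u `^ (r%:R - alpha) * (1 - u / n%:R) ^+ n)%:E <=
   (h * ((2 * h) ^+ r * h `^ (- alpha) * (1 - h / n%:R) ^+ n))%:E)%E.
Proof.
move=> alpha0 n2 h0 h1.
set c := (2 * h) ^+ r * h `^ (- alpha) * (1 - h / n%:R) ^+ n.
have -> : ((h * c)%:E = \int[mu]_(u in `]h, (2 * h)%R]) cst c%:E u)%E.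
  rewrite integral_cst//= lebesgue_measure_itv/= lte_fin.
  have -> : h < 2 * h by lra.
  by rewrite -EFinD -EFinM; congr _%:E; ring.
apply: ge0_le_integral => //.
- move=> u /=; rewrite in_itv/= => /andP[hu uh].
  by rewrite lee_fin mulr_ge0 ?powR_ge0// exp_one_sub_ge0//; lra.
- by apply: measurable_powR_mul => //; exact: measurable_exp_one_sub.
move=> u /=; rewrite in_itv/= => /andP[hu uh].
have u0 : 0 < u by lra.
rewrite lee_fin; apply: ler_pM.
- exact: powR_ge0.
- by apply: exp_one_sub_ge0 => //; lra.
- rewrite powRD; last by apply/implyP => _; rewrite gt_eqF.
  apply: ler_pM; rewrite ?powR_ge0//.
    by rewrite powR_mulrn ?(ltW u0)// lerXn2r// nnegrE; lra.
  rewrite !powRN lef_pV2 ?posrE ?powR_gt0//.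
  by apply: ge0_ler_powR => //; rewrite ?nnegrE; lra.
- by apply: exp_one_sub_antitone => //; lra.
Qed.

(** A lower bound for the contribution of the atoms of mass between [dyadic k.+1 / n] and
    [dyadic k / n], up to factors independent of [k]. *)
Definition dyadic_term (alpha : R) (r n k : nat) : R :=
  dyadic k.+1 ^+ r.+1 * dyadic k.+1 `^ (- alpha) * (1 - dyadic k / n%:R) ^+ n.

(** With [h = dyadic k.+1], block [k] is [2h < u <= 4h], and next to the
    common factor [(1 - 2h/n)^n] its bound is [2h (4h)^r (2h)^(-alpha)], that
    is, [2^(1-alpha) 4^r] times [h^(r+1) h^(-alpha)]. *)
Lemma integral_le_dyadic_sum (alpha B : R) (r n : nat) :
  0 <= alpha -> (2 <= n)%N ->
  (forall K, \sum_(k < K) dyadic_term alpha r n k <= B) ->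
  (\int[mu]_(u in `]0%R, 2%R])
     (u `^ (r%:R - alpha) * (1 - u / n%:R) ^+ n)%:E <=
   (2 `^ (1 - alpha) * 4 ^+ r * B)%:E)%E.
Proof.
move=> alpha0 n2 SB; rewrite itv02_bigcup ge0_integral_bigcup//; last 3 first.
- by apply: measurable_powR_mul; [|apply: measurable_exp_one_sub];
    exact: bigcup_measurable.
- rewrite -itv02_bigcup => u /=; rewrite in_itv/= => /andP[_ u2].
  by rewrite lee_fin mulr_ge0 ?powR_ge0 ?exp_one_sub_ge0.
- exact: trivIset_dyadic.
apply: lime_le.
  apply: is_cvg_nneseries => k _ _; apply: integral_ge0 => u /=.
  rewrite in_itv/= => /andP[_ uk].
  rewrite lee_fin mulr_ge0 ?powR_ge0 ?exp_one_sub_ge0//.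
  by have := dyadic_le1 k; lra.
apply: nearW => K; rewrite big_mkord.
apply: (@le_trans _ _ (2 `^ (1 - alpha) * 4 ^+ r *
    \sum_(k < K) dyadic_term alpha r n k)%:E); last first.
  by rewrite lee_fin ler_wpM2l// mulr_ge0 ?powR_ge0// exprn_ge0.
rewrite mulr_sumr -sumEFin; apply: lee_sum => k _.
apply: le_trans (integral_dyadic_block_le r alpha0 n2 (dyadic_gt0 k) (dyadic_le1 k)) _.
rewrite lee_fin le_eqVlt; apply/orP; left; apply/eqP.
rewrite /dyadic_term; set z := (1 - _) ^+ n; rewrite dyadicS.
set h := dyadic k.+1; have h0 : 0 < h := dyadic_gt0 _.
rewrite [(2 * h) `^ _]powRM// ?ltW//.
rewrite powRD ?powRr1//; last by apply/implyP.
have -> : 2 * (2 * h) = 4 * h by ring.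
by rewrite exprMn [h ^+ r.+1]exprS; ring.
Qed.
End dyadic.

(** * The bound for the expectation *)

Section lower_bound.
Context {R : realType} {A : countType} (p : A -> R).
Context (alpha : R) (l : R -> R) (n : nat).
Hypothesis hp : is_distribution p.
Hypothesis hnu : forall eps : R, 0 < eps <= 1 ->
  eps `^ (- alpha) * l (1 / eps) <= (nu p eps)%:R.
Hypothesis hmono : forall x y : R, 0 <= x -> x <= y -> l x <= l y.
Hypothesis n2 : (2 <= n)%N.
Hypothesis hl_ge0 : 0 <= l n%:R.

Let n_gt0 : (0 : R) < n%:R. Proof. by rewrite ltr0n; lia. Qed.
Let n_ge1 : (1 : R) <= n%:R. Proof. by rewrite ler1n; lia. Qed.

(** The hypothesis on [nu] at [h/n], with [l (n/h)] bounded below by [l n]: this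
    is where the monotonicity of [l] enters. *)
Lemma nu_div_ge (h : R) : 0 < h <= 1 ->
  h `^ (- alpha) * (n%:R `^ alpha * l n%:R) <= (nu p (h / n%:R))%:R.
Proof.
move=> /andP[h0 h1]; have hn0 : 0 < h / n%:R by rewrite divr_gt0.
have hn1 : h / n%:R <= 1 by rewrite ler_pdivrMr// mul1r (le_trans h1).
apply: le_trans (hnu _); last by rewrite hn0.
have -> : (h / n%:R) `^ (- alpha) = h `^ (- alpha) * n%:R `^ alpha.
  rewrite powRM ?invr_ge0 ?(ltW h0)//; congr (_ * _).
  by rewrite -powR_inv1// -powRrM mulN1r opprK.
rewrite -mulrA ler_wpM2l ?powR_ge0// ler_wpM2l ?powR_ge0//.
apply: hmono => //; rewrite div1r invf_div ler_pdivlMr//.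
by rewrite ler_piMr// ltW.
Qed.

(** [nu (h/n)] is at most [(1 + kappa0)/2] times [nu (h/2/n)], so at least the
    fraction [(1 - kappa0)/2] of the latter count is new. *)
Lemma nu_increment_ge (h : R) : 0 < h <= 1 ->
  kappa_minus p (2 / n%:R) <= (1 + kappa0 p) / 2 -> kappa0 p < 1 ->
  (1 - kappa0 p) / 2 * ((h / 2) `^ (- alpha) * (n%:R `^ alpha * l n%:R)) <=
  (nu p (h / 2 / n%:R))%:R - (nu p (h / n%:R))%:R.
Proof.
move=> /andP[h0 h1] hkap hkap1.
have hn0 : 0 < h / n%:R by rewrite divr_gt0.
have hn2 : h / n%:R <= 2 / n%:R by rewrite ler_pM2r ?invr_gt0//; lra.
have := nu_le_kappa hp hn0 hn2.
have -> : h / n%:R / 2 = h / 2 / n%:R by rewrite mulrAC.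
set N := (nu p (h / 2 / n%:R))%:R => le1.
have N0 : 0 <= N :> R by rewrite ler0n.
have le2 : (h / 2) `^ (- alpha) * (n%:R `^ alpha * l n%:R) <= N.
  by apply: nu_div_ge; apply/andP; split; lra.
have le3 := ler_wpM2r N0 hkap.
have c0 : 0 <= (1 - kappa0 p) / 2 by lra.
have le4 := ler_wpM2l c0 le2.
by lra.
Qed.

(** The levels [dyadic k / n] turn the factor [n^r] and the powers [r + 1] of the
    masses into a single [1/n], so that every block contributes the same
    [l n / n^(1-alpha)] times its [dyadic_term].  Only [K] blocks are used: the
    bound holds for all partial sums. *)
Lemma expectation_lower_bound (r K : nat) : (r <= n)%N ->
  kappa_minus p (2 / n%:R) <= (1 + kappa0 p) / 2 -> kappa0 p < 1 ->
  expR (- r%:R) / 2 <= (1 - r%:R / n%:R : R) ^+ n ->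
  forall (d : measure_display) (T : measurableType d) (Pr : probability T R)
    (X : 'I_n -> T -> A), iid_with_law p Pr X ->
  ((expR (- r%:R) / (2 * (r`!)%:R) *
    ((1 - pstar p) ^+ n +
     (1 - kappa0 p) / 2 * \sum_(k < K) dyadic_term alpha r n k) *
    (l n%:R / n%:R `^ (1 - alpha)))%:E <= 'E_Pr[M p X r])%E.
Proof.
move=> rn hkap hkap1 hexp d T Pr X Xiid; have p01 := hp.1.
apply: le_trans (expectation_M_ge hp Xiid
  (fset_set [set a | dyadic K / n%:R <= p a]) rn).
rewrite lee_fin.
pose v k : R := dyadic k / n%:R.
have v01 k : 0 < v k <= 1.
  rewrite divr_gt0 ?dyadic_gt0//= ler_pdivrMr// mul1r.
  exact: le_trans (dyadic_le1 _) n_ge1.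
have vdec k : v k.+1 <= v k.
  by rewrite ler_pM2r ?invr_gt0// dyadic_antitone.
set W := expR (- r%:R) / (2 * (r`!)%:R).
have W0 : 0 <= W by rewrite divr_ge0 ?expR_ge0// mulr_ge0.
apply: (@le_trans _ _ (W * (n%:R ^+ r *
   \sum_(a <- fset_set [set a | v K <= p a]) p a ^+ r.+1 * (1 - p a) ^+ n)));
  last first.
  rewrite !mulr_sumr; apply: ler_sum => a _.
  by apply: binomial_weight_ge => //; lia.
rewrite -mulrA; apply: ler_wpM2l => //.
have := sum_large_atoms_ge hp r.+1 n K v01 vdec.
have nr0 : (0 : R) <= n%:R ^+ r by rewrite exprn_ge0// ltW.
move=> /(ler_wpM2l nr0); apply: le_trans.
set y := n%:R `^ alpha.
have y0 : 0 < y by rewrite powR_gt0.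
have -> : n%:R `^ (1 - alpha) = n%:R / y.
  rewrite powRD; last by apply/implyP => _; rewrite gt_eqF.
  by rewrite powRN powRr1// ltW.
have scale (z : R) : n%:R ^+ r * (z / n%:R) ^+ r.+1 = z ^+ r.+1 / n%:R.
  rewrite exprMn exprVn [n%:R ^+ r.+1]exprS; field.
  by rewrite expf_neq0 ?gt_eqF.
have -> : l n%:R / (n%:R / y) = y * l n%:R / n%:R.
  by field; rewrite !gt_eqF.
have ps0 : 0 <= (1 - pstar p) ^+ n.
  by rewrite exprn_ge0// subr_ge0 pstar_le1.
rewrite mulrDl mulrDr; apply: lerD.
  rewrite [leRHS]mulrCA [n%:R ^+ r * _]mulrA /v scale /dyadic expr0 expr1n.
  have := @nu_div_ge 1; rewrite ltr01 lexx powR1 mul1r div1r => /(_ isT) le1.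
  have -> : (1 - pstar p) ^+ n * (y * l n%:R / n%:R) =
    (y * l n%:R) * ((1 - pstar p) ^+ n / n%:R) by ring.
  rewrite [_^-1 * _]mulrC.
  by apply: ler_wpM2r => //; rewrite mulr_ge0// invr_ge0 ltW.
rewrite [leRHS]mulr_sumr [_ * \sum_(k < K) _]mulr_sumr mulr_suml; apply: ler_sum => k _.
have hk : 0 < (dyadic k : R) <= 1 by rewrite dyadic_gt0 dyadic_le1.
have := nu_increment_ge hk hkap hkap1.
have -> : dyadic k / 2 = dyadic k.+1 :> R.
  by rewrite (dyadicS k) mulrC mulKf.
rewrite -/(v _) -/(v _) => le1.
rewrite [leRHS]mulrCA [n%:R ^+ r * _]mulrA [v k.+1]/v scale.
rewrite /dyadic_term -/(v k).
set z := (1 - v k) ^+ n.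
have z0 : 0 <= z by rewrite exprn_ge0// subr_ge0; have /andP[] := v01 k.
set w := dyadic k.+1 ^+ r.+1 / n%:R * z.
have w0 : 0 <= w.
  by rewrite mulr_ge0// divr_ge0// ?(ltW n_gt0)// exprn_ge0// ltW// dyadic_gt0.
have := ler_wpM2r w0 le1; apply: le_trans.
rewrite le_eqVlt; apply/orP; left; apply/eqP.
by rewrite /w /y; ring.
Qed.
End lower_bound.

Unset Implicit Arguments.

Theorem corollary2p5 (R : realType) (A : countType) (p : A -> R)
    (alpha : R) (l : R -> R) (r : nat)
    (hp : is_distribution p)
    (hkappa : kappa0 p < 1)
    (halpha : 0 <= alpha <= 1)
    (hl : slowly_varying l)
    (hnu : forall eps : R, 0 < eps <= 1 ->
       eps `^ (- alpha) * l (1 / eps) <= (nu p eps)%:R)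
    (hmono : forall x y : R, 0 <= x -> x <= y -> l x <= l y) :
  exists n0 : nat,
    is_least (n0_conditions p alpha r) n0 /\
    forall n : nat, (n0 <= n)%N ->
    forall (d : measure_display) (T : measurableType d) (Pr : probability T R)
      (X : 'I_n -> T -> A), iid_with_law p Pr X ->
    ((expR (- r%:R) / (2 * (r`!)%:R))%:E *
       (((1 - pstar p) ^+ n)%:E +
        ((1 - kappa0 p) / (2 `^ (1 - alpha) * 4 ^+ (1 + r)))%:E *
          lower_gamma (1 + r%:R - alpha) 2) *
       (l n%:R / n%:R `^ (1 - alpha))%:E
     <= 'E_Pr[M p X r])%E.
Proof.
have [n0 n0P] := exists_least (exists_n0_conditions alpha r hp hkappa).
exists n0; split=> // n n0n d T Pr X Xiid.
have [n2' hkap hexp hint] := n0_conditions_upward hp n0n n0P.1.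
have n2 : (2 <= n)%N by lia.
have rn : (r <= n)%N by lia.
have ngt0 : (0 : R) < n%:R by rewrite ltr0n; lia.
have y0 : 0 < n%:R `^ (1 - alpha) by rewrite powR_gt0.
have EM0 : (0 <= 'E_Pr[M p X r])%E.
  by have := expectation_M_ge hp Xiid fset0 rn; rewrite big_seq_fset0.
have gamma0 : (0 <= lower_gamma (1 + r%:R - alpha) 2)%E.
  by apply: integral_ge0 => u _; rewrite lee_fin mulr_ge0 ?powR_ge0 ?expR_ge0.
have P0 : 0 <= (1 - pstar p) ^+ n by rewrite exprn_ge0// subr_ge0 pstar_le1.
have W0 : 0 < expR (- r%:R) / (2 * (r`!)%:R) :> R.
  by rewrite divr_gt0 ?expR_gt0// mulr_gt0// ltr0n fact_gt0.
pose D : R := 2 `^ (1 - alpha) * 4 ^+ r.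
have D0 : 0 < D by rewrite mulr_gt0 ?powR_gt0 ?exprn_gt0.
have DE : 2 `^ (1 - alpha) * 4 ^+ (1 + r) = 4 * D by rewrite exprS mulrCA.
rewrite DE.
have c0 : 0 <= (1 - kappa0 p) / (4 * D) by rewrite divr_ge0; lra.
(* [gamma] may be infinite here; a non-positive bound holds all the same. *)
have [l0|l0] := leP (l n%:R) 0.
  apply: le_trans EM0; apply: mule_ge0_le0; last first.
    by rewrite lee_fin pmulr_lle0// invr_gt0.
  by rewrite mule_ge0 ?adde_ge0 ?mule_ge0// lee_fin// ltW.
have := @expectation_lower_bound R A p alpha l n hp hnu hmono n2 (ltW l0) r.
move=> /(_ _ rn hkap hkappa hexp d T Pr X Xiid).
case: ('E_Pr[M p X r])%E EM0 => [e| |]//; last by move=> _ _; rewrite leey.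
move=> _ lower.
set W := expR _ / _ in W0 lower *.
set L := l _ / _ in lower *.
set P := (1 - pstar p) ^+ n in P0 lower *.
have L0 : 0 < L by rewrite divr_gt0.
(* [B] is the value of the dyadic series for which the lower bound would equal
   [e]; all partial sums stay below it. *)
pose B := (e / (W * L) - P) / ((1 - kappa0 p) / 2).
have SB K : \sum_(k < K) dyadic_term alpha r n k <= B.
  rewrite ler_pdivlMr; last by lra.
  rewrite lerBrDl (ler_pdivlMr _ _ (mulr_gt0 W0 L0)).
  have := lower K; rewrite lee_fin; apply: le_trans.
  rewrite le_eqVlt; apply/orP; left; apply/eqP; ring.
have [alpha0 _] := andP halpha.
have := le_trans hint (integral_le_dyadic_sum alpha0 n2 SB); rewrite -/D.
(* Half of [gamma] is at most the real number [D * B], hence [gamma] is real. *)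
case: (lower_gamma _ _) gamma0 => [g| |]//; last first.
  by rewrite gt0_mulye// lte_fin invr_gt0.
rewrite -EFinM !lee_fin => g0 gB.
have gB' : (1 - kappa0 p) / (4 * D) * g <= e / (W * L) - P.
  have -> : e / (W * L) - P = (1 - kappa0 p) / (4 * D) * (2 * (D * B)).
    by rewrite /B; field; rewrite !gt_eqF//; lra.
  by rewrite ler_wpM2l//; lra.
rewrite mulrAC -(ler_pdivlMl _ _ (mulr_gt0 W0 L0)) [leRHS]mulrC.
by move: gB'; lra.
Qed.
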